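(* Let $\bar z\in\mathbb R^n$ be a local minimizer of (P). Then the following assertions hold. (a) If $H_M$ is metrically subregular at $(\bar z,(0,0))$, then $\bar z$ is implicitly M-stationary. (b) If $\mathcal H_M$ is metrically subregular at $((\bar z,\bar\lambda),(0,0,0))$ for some $\bar\lambda\in K(\bar z)$, then $\bar z$ is fuzzily M-stationary w.r.t. $\bar\lambda$. (c) If $\mathfrak H_M$ is metrically subregular at $((\bar z,\bar\lambda),((0,0),(0,0,0),0))$ for some $\bar\lambda\in K(\bar z)$, then $\bar z$ is explicitly M-stationary w.r.t. $\bar\lambda$.
   Context: Let $f\colon\mathbb R^n\to\mathbb R$ be locally Lipschitz continuous, let $F\colon\mathbb R^n\rightrightarrows\mathbb R^m$ and $G\colon\mathbb R^n\times\mathbb R^m\rightrightarrows\mathbb R^s$ be set-valued mappings with closed graphs, and let $M\subset\mathbb R^n$ be nonempty and closed. Set $H(z):=\bigcup_{\lambda\in F(z)}G(z,\lambda)$; it is assumed that $\operatorname{gph}H$ is (locally) closed. Problem (P): minimize $f(z)$ over $z\in\mathbb R^n$ subject to $0\in H(z)$, $z\in M$. Put $K(z):=\{\lambda\in F(z)\mid 0\in G(z,\lambda)\}$. Auxiliary mappings: $H_M(z):=H(z)\times(z-M)$; $\mathcal H(z,\lambda):=(F(z)-\lambda)\times G(z,\lambda)$; $\mathcal H_M(z,\lambda):=\mathcal H(z,\lambda)\times(z-M)$; $\mathfrak H_M(z,\lambda):=\big((z,\lambda)-\operatorname{gph}F\big)\times\big((z,\lambda,0)-\operatorname{gph}G\big)\times(z-M)$.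 Variational analysis: products carry the sum of Euclidean norms; $\operatorname{dist}(z,A)=\inf_{a\in A}\|a-z\|$ ($=+\infty$ if $A=\varnothing$). A mapping $\Upsilon$ is metrically subregular at $(\bar z,\bar w)\in\operatorname{gph}\Upsilon$ if there are $\kappa>0$ and a neighborhood $U$ of $\bar z$ with $\operatorname{dist}(z,\Upsilon^{-1}(\bar w))\le\kappa\operatorname{dist}(\bar w,\Upsilon(z))$ for all $z\in U$, where $\Upsilon^{-1}(w)=\{z\mid w\in\Upsilon(z)\}$. For a closed set $A$ and $\bar z\in A$: $\mathcal T_A(\bar z)$ is the Bouligand tangent cone, $\widehat{\mathcal N}_A(\bar z)$ its polar, and the limiting normal cone $\mathcal N_A(\bar z)$ consists of all limits $\xi=\lim\xi_k$ with $\xi_k\in\widehat{\mathcal N}_A(z_k)$, $z_k\in A$, $z_k\to\bar z$. The limiting subdifferential is $\partial f(\bar z)=\{\xi\mid(\xi,-1)\in\mathcal N_{\operatorname{epi}f}(\bar z,f(\bar z))\}$, and the limiting coderivative is $D^*\Upsilon(\bar z,\bar w)(\eta)=\{\xi\mid(\xi,-\eta)\in\mathcal N_{\operatorname{gph}\Upsilon}(\bar z,\bar w)\}$. A feasible point $\bar z$ of (P) is called - implicitly M-stationary if there is $\nu\in\mathbb R^s$ with $0\in\partial f(\bar z)+D^*H(\bar z,0)(\nu)+\mathcal N_M(\bar z)$; - fuzzily M-stationary w.r.t. $\bar\lambda\in K(\bar z)$ if there are $\mu\in\mathbb R^m$, $\nu\in\mathbb R^s$ with $(0,0)\in\partial f(\bar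 z)\times\{0\}+D^*\mathcal H((\bar z,\bar\lambda),(0,0))(\mu,\nu)+\mathcal N_M(\bar z)\times\{0\}$; - explicitly M-stationary w.r.t. $\bar\lambda\in K(\bar z)$ if there are $\mu\in\mathbb R^m$, $\nu\in\mathbb R^s$ with $0\in\partial f(\bar z)+D^*F(\bar z,\bar\lambda)(\mu)+\{\xi\in\mathbb R^n\mid(\xi,\mu)\in D^*G((\bar z,\bar\lambda),0)(\nu)\}+\mathcal N_M(\bar z)$. *)

(* Defs.v *)
From HB Require Import structures.
From mathcomp Require Import all_boot all_order all_algebra.
From mathcomp Require Import all_classical all_reals all_analysis.

Set Implicit Arguments.
Unset Strict Implicit.
Unset Printing Implicit Defensive.

Import Order.TTheory GRing.Theory Num.Theory.
Import numFieldNormedType.Exports.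

Local Open Scope classical_set_scope.
Local Open Scope ring_scope.

(* The norm that the library puts on ['rV[R]_n] and on products is the maximum
   norm. It is used here for the topology only, which is the Euclidean one.
   Polars are taken with respect to [inner], and distances with respect to
   [enorm], which is the Euclidean norm on ['rV[R]_n] and the sum of the norms
   of the components on products; the latter is thus not the norm induced by
   [inner]. The structure only carries the two operations; its instances are
   [R^o], ['rV[R]_n] and their products. *)
HB.mixin Record NormedModule_hasInner (R : realType) V of NormedModule R V := {
  inner : V -> V -> R;
  enorm : V -> R
}.

#[short(type="innerModType")]
HB.structure Definition InnerModule (R : realType) :=
  {V of NormedModule_hasInner R V & NormedModule R V}.

HB.instance Definition _ (R : realType) :=
  NormedModule_hasInner.Build R R^o (fun x y : R => x * y) (fun x : R => `|x|).

HB.instance Definition _ (R : realType) (n : nat) :=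
  NormedModule_hasInner.Build R 'rV[R]_n
    (fun x y => \sum_i x ord0 i * y ord0 i)
    (fun x => Num.sqrt (\sum_i x ord0 i ^+ 2)).

HB.instance Definition _ (R : realType) (U V : innerModType R) :=
  NormedModule_hasInner.Build R (U * V)%type
    (fun p q => inner p.1 q.1 + inner p.2 q.2)
    (fun p => enorm p.1 + enorm p.2).

Definition minkowski_sum (V : zmodType) (A B : set V) : set V :=
  [set a + b | a in A & b in B].

Notation "A `\+` B" := (minkowski_sum A B)
  (at level 50, left associativity) : classical_set_scope.

(* C is closed near each of its points. *)
Definition locally_closed (T : topologicalType) (C : set T) : Prop :=
  forall x, C x -> exists U, [/\ nbhs x U, closed U & closed (C `&` U)].

Section variational_analysis.
Context {R : realType}.
Implicit Types U V : innerModType R.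

(* [ereal_inf set0] is [+oo]. *)
Definition set_dist V (z : V) (A : set V) : \bar R :=
  ereal_inf [set (enorm (a - z))%:E | a in A].

Definition gph U V (Y : U -> set V) : set (U * V) := [set p | Y p.1 p.2].

Definition metrically_subregular U V (Y : U -> set V) (z : U) (w : V) : Prop :=
  gph Y (z, w) /\
  exists2 kappa : R, 0 < kappa &
    \forall x \near z,
      (set_dist x [set x' | Y x' w] <= kappa%:E * set_dist w (Y x))%E.

Definition tangent_cone V (A : set V) (z : V) : set V :=
  [set d | exists (t : nat -> R) (u : nat -> V),
    [/\ forall k, 0 < t k,
        t k @[k --> \oo] --> 0,
        u k @[k --> \oo] --> d
      & forall k, A (z + t k *: u k)]].

Definition polar V (T : set V) : set V :=
  [set xi | forall d, T d -> inner xi d <= 0].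

Definition regular_normal V (A : set V) (z : V) : set V :=
  polar (tangent_cone A z).

Definition limiting_normal V (A : set V) (z : V) : set V :=
  [set xi | exists (zs xis : nat -> V),
    [/\ forall k, A (zs k),
        forall k, regular_normal A (zs k) (xis k),
        zs k @[k --> \oo] --> z
      & xis k @[k --> \oo] --> xi]].

Definition epi V (f : V -> R) : set (V * R^o) := [set p | f p.1 <= p.2].

Definition limiting_subdiff V (f : V -> R) (z : V) : set V :=
  [set xi | limiting_normal (epi f) (z, f z) (xi, -1)].

Definition coderivative U V (Y : U -> set V) (z : U) (w : V) (eta : V) : set U :=
  [set xi | limiting_normal (gph Y) (z, w) (xi, - eta)].

(* The library's Lipschitz condition is with respect to the maximum norm; only
   the Lipschitz constants depend on this choice. *)
Definition locally_lipschitz V (f : V -> R) : Prop :=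
  forall z : V, exists2 W, nbhs z W & [lipschitz (f x : R^o) | x in W].

End variational_analysis.

Section implicit_variables.
Context {R : realType} {n m s : nat}.
Variables (f : 'rV[R]_n -> R) (F : 'rV[R]_n -> set 'rV[R]_m)
  (G : 'rV[R]_n * 'rV[R]_m -> set 'rV[R]_s) (M : set 'rV[R]_n).

Definition Hmap (z : 'rV[R]_n) : set 'rV[R]_s :=
  \bigcup_(lambda in F z) G (z, lambda).

Definition Kmap (z : 'rV[R]_n) : set 'rV[R]_m :=
  [set lambda | F z lambda /\ G (z, lambda) 0].

Definition Hmap_M (z : 'rV[R]_n) : set ('rV[R]_s * 'rV[R]_n) :=
  Hmap z `*` [set z - x | x in M].

Definition calH (p : 'rV[R]_n * 'rV[R]_m) : set ('rV[R]_m * 'rV[R]_s) :=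
  [set lambda - p.2 | lambda in F p.1] `*` G p.

Definition calHM (p : 'rV[R]_n * 'rV[R]_m) :
    set ('rV[R]_m * 'rV[R]_s * 'rV[R]_n) :=
  calH p `*` [set p.1 - x | x in M].

Definition frakHM (p : 'rV[R]_n * 'rV[R]_m) :
    set ('rV[R]_n * 'rV[R]_m * ('rV[R]_n * 'rV[R]_m * 'rV[R]_s) * 'rV[R]_n) :=
  [set p - q | q in gph F] `*` [set (p, 0) - q | q in gph G]
    `*` [set p.1 - x | x in M].

Definition feasible (z : 'rV[R]_n) : Prop := Hmap z 0 /\ M z.

Definition local_minimizer (z : 'rV[R]_n) : Prop :=
  feasible z /\ \forall x \near z, feasible x -> f z <= f x.

Definition implicitly_M_stationary (z : 'rV[R]_n) : Prop :=
  feasible z /\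
  exists nu : 'rV[R]_s,
    (limiting_subdiff f z `\+` coderivative Hmap z 0 nu
       `\+` limiting_normal M z) 0.

Definition fuzzily_M_stationary (z : 'rV[R]_n) (lambda : 'rV[R]_m) : Prop :=
  [/\ feasible z, Kmap z lambda &
    exists (mu : 'rV[R]_m) (nu : 'rV[R]_s),
      (limiting_subdiff f z `*` [set 0]
         `\+` coderivative calH (z, lambda) (0, 0) (mu, nu)
         `\+` limiting_normal M z `*` [set 0]) (0, 0)].

Definition explicitly_M_stationary (z : 'rV[R]_n) (lambda : 'rV[R]_m) : Prop :=
  [/\ feasible z, Kmap z lambda &
    exists (mu : 'rV[R]_m) (nu : 'rV[R]_s),
      (limiting_subdiff f z
         `\+` coderivative F z lambda mu
         `\+` [set xi | coderivative G (z, lambda) 0 nu (xi, mu)]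
         `\+` limiting_normal M z) 0].

End implicit_variables.

(* Main.v *)
Require Import Defs.
From HB Require Import structures.
From mathcomp Require Import all_boot all_order all_algebra.
From mathcomp Require Import all_classical all_reals all_analysis.
From mathcomp Require Import ring lra.

(** Metric subregularity turns the constraint into an exact penalty, and the
    penalty is then decoupled: points of [epi f], of the graphs and of [M] vary
    independently over a product set [Om], and the local minimizer minimizes over
    [Om] an objective <c, p> + C |A p| with [A] linear and vanishing at the
    minimizer. Replacing |A p| by sqrt (|A p|^2 + e^2) and adding |p - p0|^2 makes
    the objective smooth, so that minus its gradient is a regular normal to [Om]
    at a minimizer over a compact neighbourhood. As e tends to 0 these minimizers
    tend to p0 while the multipliers remain in the ball of radius C, and a cluster
    point y of the multipliers gives a limiting normal - (c + A' y), [A'] being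
    the adjoint of [A]. The components of this vector are the normals of the
    stationarity systems; they add up as required because the coupling term [A]
    only involves differences of the decoupled variables. *)

Set Implicit Arguments.
Unset Strict Implicit.
Unset Printing Implicit Defensive.

Import Order.TTheory GRing.Theory Num.Theory.
Import numFieldNormedType.Exports.

Local Open Scope classical_set_scope.
Local Open Scope ring_scope.

(* [innerModType] imposes no law on [inner] and [enorm]; [`|x|] is the maximum
   norm in the instances, hence the inequalities between the three. *)
Class euclidean (R : realType) (V : innerModType R) : Prop := Euclidean {
  innerC : forall x y : V, inner x y = inner y x;
  innerDl : forall x y z : V, inner (x + y) z = inner x z + inner y z;
  innerZl : forall (a : R) (x y : V), inner (a *: x) y = a * inner x y;
  inner_continuous : continuous (fun p : V * V => inner p.1 p.2 : R);
  norm_le_inner : forall x : V, `|x| ^+ 2 <= inner x x;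
  norm_le_enorm : forall x : V, `|x| <= enorm x;
  enorm_le_inner : exists2 C : R, 0 <= C &
    forall x : V, enorm x <= C * Num.sqrt (inner x x);
  compact_norm_ball : forall r : R, compact [set x : V | `|x| <= r] }.

(** * Inner products and norms on the reals, row vectors and products *)

Section euclidean_theory.
Context {R : realType}.

Lemma continuous_fst (U V : topologicalType) : continuous (@fst U V).
Proof. by move=> x; exact: cvg_fst. Qed.

Lemma continuous_snd (U V : topologicalType) : continuous (@snd U V).
Proof. by move=> x; exact: cvg_snd. Qed.

Lemma norm_ball_compact_of_bounded (V : normedModType R) (r : R) :
  (forall A : set V, bounded_set A -> closed A -> compact A) ->
  compact [set x : V | `|x| <= r].
Proof.
move=> bcc; apply: bcc; last first.
  apply: (@closed_comp _ _ (fun x : V => `|x|) [set y : R | y <= r]).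
    by move=> x _; exact: norm_continuous.
  exact: closed_le.
exists r; split; first exact: num_real.
by move=> s rs x /= xr; apply: le_trans xr (ltW rs).
Qed.

#[export] Instance euclidean_R : euclidean (R^o : innerModType R).
Proof.
split; rewrite /inner/= /enorm/=.
- by move=> x y; rewrite mulrC.
- by move=> x y z; rewrite mulrDl.
- by move=> a x y; rewrite [a *: x]/(a * x) mulrA.
- by move=> p; apply: cvgM; [exact: cvg_fst|exact: cvg_snd].
- by move=> x; rewrite real_normK ?num_real// expr2.
- by [].
- by exists 1 => // x; rewrite mul1r -expr2 sqrtr_sqr.
- move=> r; have -> : [set x : R^o | `|x| <= r] = `[(- r), r]%classic.
    by apply/seteqP; split => x /=; rewrite in_itv/= ler_norml.
  exact: segment_compact.
Qed.

#[export] Instance euclidean_rV n : euclidean ('rV[R]_n : innerModType R).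
Proof.
have nsq (x : 'rV[R]_n) : `|x| ^+ 2 <= \sum_i x ord0 i * x ord0 i.
  have [/eqP ->|x0] := boolP (x == 0).
    by rewrite normr0 expr0n/=; apply: sumr_ge0 => i _; rewrite mxE mulr0.
  (* The maximum norm is attained at some entry, whose square is one of the nonnegative summands. *)
  have /mx_norm_neq0[[i j]] : mx_norm x != 0.
    by apply: contra x0 => /eqP x0; apply/eqP/mx_norm_eq0.
  rewrite -[mx_norm x]/(`|x|) => ->/=; rewrite (ord1 i) (bigD1 j)//=.
  rewrite real_normK ?num_real// expr2 lerDl.
  by apply: sumr_ge0 => k _; rewrite -expr2 sqr_ge0.
have sq (x : 'rV[R]_n) : \sum_i x ord0 i * x ord0 i = \sum_i x ord0 i ^+ 2.
  by apply: eq_bigr => i _; rewrite expr2.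
split; rewrite /inner/= /enorm/=.
- by move=> x y; apply: eq_bigr => i _; rewrite mulrC.
- by move=> x y z; rewrite -big_split/=; apply: eq_bigr => i _; rewrite mxE mulrDl.
- by move=> a x y; rewrite mulr_sumr; apply: eq_bigr => i _; rewrite mxE mulrA.
- apply: continuous_big => [|i _ p]; first exact: add_continuous.
  apply: cvgM.
    apply: (@continuous_comp _ _ _ fst (fun x : 'rV[R]_n => x ord0 i)).
      exact: continuous_fst.
    exact: coord_continuous.
  apply: (@continuous_comp _ _ _ snd (fun x : 'rV[R]_n => x ord0 i)).
      exact: continuous_snd.
    exact: coord_continuous.
- exact: nsq.
- by move=> x; rewrite -sq -[leLHS]normr_id -sqrtr_sqr ler_wsqrtr.
- by exists 1 => // x; rewrite mul1r sq.
- by move=> r; apply: norm_ball_compact_of_bounded; exact: bounded_closed_compact.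
Qed.

#[export] Instance euclidean_prod (U V : innerModType R) :
  euclidean U -> euclidean V -> euclidean ((U * V)%type : innerModType R).
Proof.
move=> eU eV; split.
- by move=> x y; rewrite /inner/= innerC [X in _ + X]innerC.
- by move=> x y z; rewrite /inner/= !innerDl addrACA.
- by move=> a x y; rewrite /inner/= !innerZl mulrDr.
- move=> p; rewrite /inner/=; apply: cvgD.
    apply: (@continuous_comp _ _ _ (fun p : (U * V) * (U * V) => (p.1.1, p.2.1))
      (fun p => inner p.1 p.2)).
      apply: cvg_pair.
        by apply: (continuous_comp (@continuous_fst _ _ p) (@continuous_fst _ _ _)).
      by apply: (continuous_comp (@continuous_snd _ _ p) (@continuous_fst _ _ _)).
    exact: inner_continuous.
  apply: (@continuous_comp _ _ _ (fun p : (U * V) * (U * V) => (p.1.2, p.2.2))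
      (fun p => inner p.1 p.2)).
    apply: cvg_pair.
      by apply: (continuous_comp (@continuous_fst _ _ p) (@continuous_snd _ _ _)).
    by apply: (continuous_comp (@continuous_snd _ _ p) (@continuous_snd _ _ _)).
  exact: inner_continuous.
- move=> x; rewrite /inner/= prod_normE maxEle; case: ifP => _.
    by apply: (le_trans (norm_le_inner _));
      rewrite lerDr (le_trans (sqr_ge0 _) (norm_le_inner _)).
  by apply: (le_trans (norm_le_inner _));
    rewrite lerDl (le_trans (sqr_ge0 _) (norm_le_inner _)).
- move=> x; rewrite /enorm/= prod_normE ge_max; apply/andP; split.
    by apply: (le_trans (norm_le_enorm _));
      rewrite lerDl (le_trans (normr_ge0 _) (norm_le_enorm _)).
  by apply: (le_trans (norm_le_enorm _));
    rewrite lerDr (le_trans (normr_ge0 _) (norm_le_enorm _)).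
- have [C C0 hC] := @enorm_le_inner _ U _; have [D D0 hD] := @enorm_le_inner _ V _.
  (* Each component's root is at most the root of the sum of both inner squares, so the constants
     add. *)
  exists (C + D); first exact: addr_ge0.
  move=> x; rewrite /enorm/= /inner/= mulrDl; apply: lerD.
    apply: (le_trans (hC _)); apply: ler_wpM2l => //; apply: ler_wsqrtr.
    by rewrite lerDl (le_trans (sqr_ge0 _) (norm_le_inner _)).
  apply: (le_trans (hD _)); apply: ler_wpM2l => //; apply: ler_wsqrtr.
  by rewrite lerDr (le_trans (sqr_ge0 _) (norm_le_inner _)).
- move=> r; have -> : [set x : U * V | `|x| <= r] =
      [set x : U | `|x| <= r] `*` [set x : V | `|x| <= r].
    by apply/seteqP; split => x /=; rewrite prod_normE ge_max => /andP.
  by apply: compact_setX; exact: compact_norm_ball.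
Qed.

Context {V : innerModType R} {eV : euclidean V}.
Implicit Types x y z : V.

Lemma innerDr x y z : inner x (y + z) = inner x y + inner x z.
Proof. by rewrite innerC innerDl !(innerC x). Qed.

Lemma innerZr (a : R) x y : inner x (a *: y) = a * inner x y.
Proof. by rewrite innerC innerZl innerC. Qed.

Lemma innerNl x y : inner (- x) y = - inner x y.
Proof. by rewrite -scaleN1r innerZl mulN1r. Qed.

Lemma innerNr x y : inner x (- y) = - inner x y.
Proof. by rewrite innerC innerNl innerC. Qed.

Lemma inner0l y : inner 0 y = 0.
Proof. by rewrite -(scale0r 0) innerZl mul0r. Qed.

Lemma inner0r y : inner y 0 = 0.
Proof. by rewrite innerC inner0l. Qed.

Lemma inner_ge0 x : 0 <= inner x x.
Proof. by rewrite (le_trans (sqr_ge0 _) (norm_le_inner _)). Qed.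

Lemma enorm_ge0 x : 0 <= enorm x.
Proof. by rewrite (le_trans (normr_ge0 _) (norm_le_enorm _)). Qed.

Lemma cvg_inner (T : Type) (F : set_system T) {FF : Filter F} (u v : T -> V) x y :
  u @ F --> x -> v @ F --> y -> inner (u t) (v t) @[t --> F] --> inner x y.
Proof.
move=> ux vy.
apply: (cvg_comp (fun t => (u t, v t)) (fun p => inner p.1 p.2 : R)).
  exact: cvg_pair ux vy.
exact: (@inner_continuous _ _ _ (x, y)).
Qed.

(** Neighbourhoods come from the maximum norm, distances from [enorm]. The bound C sqrt <x - y, x -
    y> links the two: it is continuous in y and vanishes at y = x. *)
Lemma near_enorm_lt x (e : R) : 0 < e -> \forall y \near x, enorm (x - y) < e.
Proof.
move=> e0; have [C C0 hC] := @enorm_le_inner _ V _.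
have h : C * Num.sqrt (inner (x - y) (x - y)) @[y --> x] -->
    C * Num.sqrt (inner (x - x) (x - x)).
  have xy : x - y @[y --> x] --> x - x by apply: cvgB; [exact: cvg_cst|exact: cvg_id].
  by apply: cvgMl_tmp; apply: (cvg_comp _ _ (cvg_inner xy xy)); exact: sqrt_continuous.
rewrite subrr inner0l sqrtr0 mulr0 in h.
have : \forall y \near x, C * Num.sqrt (inner (x - y) (x - y)) < e.
  by apply: (cvgr_lt _ h).
by apply: filterS => y; apply: le_lt_trans.
Qed.

End euclidean_theory.

(* Concavity of the square root: this replaces differentiating the smoothed norm. *)
Lemma le_sqrt_tangent (R : realType) (a b : R) : 0 < a -> 0 <= b ->
  Num.sqrt b <= Num.sqrt a + (b - a) / (2 * Num.sqrt a).
Proof.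
move=> a0 b0; have s0 : 0 < Num.sqrt a by rewrite sqrtr_gt0.
have aE : a = Num.sqrt a ^+ 2 by rewrite sqr_sqrtr// ltW.
have bE : b = Num.sqrt b ^+ 2 by rewrite sqr_sqrtr.
rewrite {2}bE {2}aE; move: s0; set s := Num.sqrt a; set t := Num.sqrt b => s0.
rewrite -subr_ge0 (_ : _ - t = (t - s) ^+ 2 / (2 * s)).
  by rewrite divr_ge0 ?sqr_ge0// mulr_ge0// ltW.
by field; rewrite gt_eqF.
Qed.

(** * Regular and limiting normals *)

Section normal_cones.
Context {R : realType}.

(** Along a tangent sequence p + t u the lower bound equals t (<g, u> + t q u) by homogeneity.
    Dividing by t > 0 and letting t tend to 0 removes [q] and leaves <g, d> >= 0. *)
Lemma regular_normal_quadratic (E : innerModType R) {eE : euclidean E}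
    (Om : set E) (p g : E) (q : E -> R) :
  continuous q -> (forall (t : R) u, q (t *: u) = t ^+ 2 * q u) ->
  (\forall x \near p, Om x -> 0 <= inner g (x - p) + q (x - p)) ->
  regular_normal Om p (- g).
Proof.
move=> cq qZ H d [t [u [t0 tc uc Au]]]; rewrite innerNl oppr_le0.
have pc : p + t k *: u k @[k --> \oo] --> p.
  rewrite -[X in _ --> X]addr0 -(scale0r d).
  by apply: cvgD; [exact: cvg_cst|exact: cvgZ].
have lc : inner g (u k) + t k * q (u k) @[k --> \oo] --> inner g d.
  rewrite -[X in _ --> X]addr0 -(mul0r (q d)).
  apply: cvgD; first exact: cvg_inner (cvg_cst g) uc.
  by apply: cvgM => //; exact: (cvg_comp _ _ uc (cq d)).
have nH : \forall k \near \oo, Om (p + t k *: u k) ->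
    0 <= inner g (p + t k *: u k - p) + q (p + t k *: u k - p) := pc _ H.
apply: (cvgr_to_ge lc); apply: filterS nH => k /(_ (Au k)).
rewrite [p + _]addrC addrK qZ innerZr expr2 -mulrA -mulrDr.
by rewrite pmulr_rge0.
Qed.

Lemma limiting_normal_approx (E : innerModType R) (Om : set E) (z xi : E) :
  (forall e : R, 0 < e -> exists p eta,
    [/\ Om p, regular_normal Om p eta, `|z - p| < e & `|xi - eta| < e]) ->
  limiting_normal Om z xi.
Proof.
move=> H.
have /choice[f fP] : forall k : nat, exists pe : E * E,
    [/\ Om pe.1, regular_normal Om pe.1 pe.2, `|z - pe.1| < harmonic k &
        `|xi - pe.2| < harmonic k].
  by move=> k; have [p [eta h]] := H (harmonic k) (harmonic_gt0 _); exists (p, eta).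
exists (fun k => (f k).1), (fun k => (f k).2).
have lim (x : E) (y : nat -> E) : (forall k, `|x - y k| < harmonic k) ->
    y k @[k --> \oo] --> x.
  move=> h; apply/cvgrPdist_lt => e e0.
  have : \forall k \near \oo, harmonic k < e by apply: (cvgr_lt _ (@cvg_harmonic R)).
  by apply: filterS => k; apply: lt_trans (h k).
split => [k|k||].
- by case: (fP k).
- by case: (fP k).
- by apply: lim => k; case: (fP k).
- by apply: lim => k; case: (fP k).
Qed.

(** If d is tangent to one factor, then (d, 0) or (0, d) is tangent to the product, the other
    coordinate staying fixed. Testing regular normals of the product on such directions shows that
    their components are regular normals, and limits are taken componentwise. *)
Lemma limiting_normal_prod (U V : innerModType R) {eU : euclidean U}
    {eV : euclidean V} (A : set U) (B : set V) (p xi : U * V) :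
  limiting_normal (A `*` B) p xi ->
  limiting_normal A p.1 xi.1 /\ limiting_normal B p.2 xi.2.
Proof.
move=> [zs [xs [zA xN zc xc]]]; split.
  exists (fun k => (zs k).1), (fun k => (xs k).1); split.
  - by move=> k; case: (zA k).
  - move=> k d [t [u [t0 tc uc Au]]].
    have := xN k (d, 0); rewrite {1}/inner/= inner0r addr0; apply.
    exists t, (fun k => (u k, 0)); split => //.
      by apply: cvg_pair => //; exact: cvg_cst.
    by move=> j; split => /=; [exact: Au|rewrite scaler0 addr0; case: (zA k)].
  - by apply: (cvg_comp _ _ zc); exact: cvg_fst.
  - by apply: (cvg_comp _ _ xc); exact: cvg_fst.
exists (fun k => (zs k).2), (fun k => (xs k).2); split.
- by move=> k; case: (zA k).
- move=> k d [t [u [t0 tc uc Au]]].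
  have := xN k (0, d); rewrite {1}/inner/= inner0r add0r; apply.
  exists t, (fun k => (0, u k)); split => //.
    by apply: cvg_pair => //; exact: cvg_cst.
  by move=> j; split => /=; [rewrite scaler0 addr0; case: (zA k)|exact: Au].
- by apply: (cvg_comp _ _ zc); exact: cvg_snd.
- by apply: (cvg_comp _ _ xc); exact: cvg_snd.
Qed.

End normal_cones.

(* Linearity of [A] follows from the last condition. *)
Definition adjoint (R : realType) (U V : innerModType R) (A : U -> V) (A' : V -> U) :=
  [/\ continuous A, continuous A' & forall x y, inner (A x) y = inner x (A' y)].

(** * Adjoint pairs of continuous linear maps *)

Section adjoint_theory.
Context {R : realType}.

Section form.
Context {U V : innerModType R} {eU : euclidean U} {eV : euclidean V}.
Variables (A : U -> V) (A' : V -> U).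
Hypothesis AA : adjoint A A'.

(** An exact second-order expansion: 2 A' (A x) is the gradient of |A x|^2 and |A h|^2 is the
    remainder. *)
Lemma adjoint_inner_sqrD x h : inner (A (x + h)) (A (x + h)) =
  inner (A x) (A x) + 2 * inner (A' (A x)) h + inner (A h) (A h).
Proof.
have [_ _ aE] := AA.
have aD y z w : inner (A (y + z)) w = inner (A y) w + inner (A z) w.
  by rewrite aE innerDl -!aE.
rewrite [inner (A' _) h]innerC -aE aD innerC aD.
by rewrite [inner (A h) (A (x + h))]innerC aD [inner (A x) (A h)]innerC; ring.
Qed.

Lemma adjoint_inner_sqrZ (t : R) x :
  inner (A (t *: x)) (A (t *: x)) = t ^+ 2 * inner (A x) (A x).
Proof.
have [_ _ aE] := AA.
have aZ y w : inner (A (t *: y)) w = t * inner (A y) w by rewrite aE innerZl -aE.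
by rewrite aZ innerC aZ expr2 mulrA.
Qed.

Lemma continuous_inner_sqr : continuous (fun x => inner (A x) (A x) : R).
Proof. by have [cA _ _] := AA; move=> x; apply: cvg_inner; exact: cA. Qed.

Lemma adjoint_scale (a : R) x y : inner (A' (a *: y)) x = a * inner (A' y) x.
Proof. by have [_ _ aE] := AA; rewrite innerC -aE innerZr aE innerC. Qed.

End form.

Lemma adjoint_id (U : innerModType R) : adjoint (@id U) id.
Proof. by split=> // x; exact: cvg_id. Qed.

Context {U V W : innerModType R} {eU : euclidean U} {eV : euclidean V} {eW : euclidean W}.

Lemma adjoint_fst : adjoint (@fst U V) (fun x => (x, 0)).
Proof.
split; first exact: continuous_fst.
- by move=> x; apply: cvg_pair; [exact: cvg_id|exact: cvg_cst].
- by move=> x y; rewrite [RHS]/inner/= inner0r addr0.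
Qed.

Lemma adjoint_snd : adjoint (@snd U V) (fun x => (0, x)).
Proof.
split; first exact: continuous_snd.
- by move=> x; apply: cvg_pair; [exact: cvg_cst|exact: cvg_id].
- by move=> x y; rewrite [RHS]/inner/= inner0r add0r.
Qed.

Lemma adjoint_comp (A : U -> V) A' (B : V -> W) B' :
  adjoint A A' -> adjoint B B' ->
  adjoint (fun x => B (A x)) (fun y => A' (B' y)).
Proof.
move=> [cA cA' aE] [cB cB' bE]; split.
- by move=> x; apply: continuous_comp; [exact: cA|exact: cB].
- by move=> x; apply: continuous_comp; [exact: cB'|exact: cA'].
- by move=> x y; rewrite bE aE.
Qed.

Lemma adjoint_pair (A : U -> V) A' (B : U -> W) B' :
  adjoint A A' -> adjoint B B' ->
  adjoint (fun x => (A x, B x)) (fun y => A' y.1 + B' y.2).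
Proof.
move=> [cA cA' aE] [cB cB' bE]; split.
- by move=> x; apply: cvg_pair; [exact: cA|exact: cB].
- move=> x; apply: cvgD.
    by apply: continuous_comp; [exact: continuous_fst|exact: cA'].
  by apply: continuous_comp; [exact: continuous_snd|exact: cB'].
- by move=> x y; rewrite [LHS]/inner/= aE bE innerDr.
Qed.

Lemma adjoint_sub (A : U -> V) A' (B : U -> V) B' :
  adjoint A A' -> adjoint B B' ->
  adjoint (fun x => A x - B x) (fun y => A' y - B' y).
Proof.
move=> [cA cA' aE] [cB cB' bE]; split.
- by move=> x; apply: cvgB; [exact: cA|exact: cB].
- by move=> x; apply: cvgB; [exact: cA'|exact: cB'].
- by move=> x y; rewrite innerDl innerNl innerDr innerNr aE bE.
Qed.

End adjoint_theory.

(** * Normals at minimizers of a linear objective with a norm penalty *)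

Section penalized_minimizers.
Context {R : realType}.

Section penalized_linear_minimizer.
Context {E V : innerModType R} {eE : euclidean E} {eV : euclidean V}.
Variables (Om : set E) (p0 c : E) (A : E -> V) (A' : V -> E) (C : R).
Hypotheses (AA : adjoint A A') (Ap0 : A p0 = 0) (C0 : 0 <= C).

Let phi (e : R) (p : E) : R := inner c p +
  C * Num.sqrt (inner (A p) (A p) + e ^+ 2) + inner (p - p0) (p - p0).

Let continuous_phi e : continuous (phi e).
Proof.
move=> p; apply: cvgD.
  apply: cvgD; first exact: cvg_inner (cvg_cst c) cvg_id.
  apply: cvgMl_tmp.
  apply: (@continuous_comp _ _ _ (fun p => inner (A p) (A p) + e ^+ 2) Num.sqrt).
    by apply: cvgD; [exact: (continuous_inner_sqr AA)|exact: cvg_cst].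
  exact: sqrt_continuous.
have h : x - p0 @[x --> p] --> p - p0 by apply: cvgB; [exact: cvg_id|exact: cvg_cst].
exact: (cvg_inner h h).
Qed.

(** The point p minimizes [phi e] over the compact set [K]. Normality is conditional because [K]
    will be [Om] cut by a ball, which agrees with [Om] near p only when p is off the sphere. *)
Lemma smoothed_penalty_minimizer (K : set E) (e : R) :
  compact K -> K p0 -> 0 < e ->
  (forall p, K p -> inner c p0 <= inner c p + C * Num.sqrt (inner (A p) (A p))) ->
  exists p y, [/\ K p, `|p - p0| ^+ 2 <= C * e, `|y| <= C &
    (\forall x \near p, Om x -> K x) ->
    regular_normal Om p (- (c + A' y + 2 *: (p - p0)))].
Proof.
move=> cK Kp0 e0 hK.
have [p /set_mem Kp pmin] : exists2 p, p \in K & forall x, x \in K -> phi e p <= phi e x.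
  by apply: compact_EVT_min => //; [exists p0|exact: continuous_subspaceT].
set s := Num.sqrt (inner (A p) (A p) + e ^+ 2).
have se0 : 0 < inner (A p) (A p) + e ^+ 2 by rewrite ltr_wpDl ?inner_ge0// exprn_gt0.
have s0 : 0 < s by rewrite sqrtr_gt0.
have sE : s ^+ 2 = inner (A p) (A p) + e ^+ 2 by rewrite sqr_sqrtr// ltW.
(* The multiplier is the gradient of C sqrt (|v|^2 + e^2) at v = A p. *)
exists p, ((C / s) *: A p); split => //.
(* At p0 the value is <c, p0> + C e, while [hK] and |A p| <= s give <c, p0> <= <c, p> + C s. Only C
   e is left to bound |p - p0|^2. *)
- have := pmin _ (mem_set Kp0); rewrite /phi Ap0 subrr !inner0l add0r addr0.
  rewrite sqrtr_sqr (gtr0_norm e0) => pp0.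
  have := hK _ Kp; have : Num.sqrt (inner (A p) (A p)) <= s.
    by rewrite ler_wsqrtr// lerDl sqr_ge0.
  move=> /(ler_wpM2l C0); rewrite -/s in pp0.
  by have := @norm_le_inner _ _ eE (p - p0); lra.
- rewrite -ler_sqr ?nnegrE//; apply: (le_trans (norm_le_inner _)).
  rewrite innerZl innerZr mulrA -expr2 expr_div_n -mulrA ler_piMr ?sqr_ge0//.
  by rewrite mulrC ler_pdivrMr ?exprn_gt0// mul1r sE lerDl sqr_ge0.
- move=> OmK.
  (* The first term is the remainder of the tangent bound for the root at s^2, the second that of |p
     - p0|^2. *)
  pose q h : R := C / (2 * s) * inner (A h) (A h) + inner h h.
  apply: (@regular_normal_quadratic _ _ _ _ _ _ q).
  + move=> h; apply: cvgD; last exact: (cvg_inner cvg_id cvg_id).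
    by apply: cvgMl_tmp; exact: (continuous_inner_sqr AA).
  + by move=> t u; rewrite /q (adjoint_inner_sqrZ AA) innerZl innerZr; ring.
  + apply: filterS OmK => x OmK Omx.
    have := pmin _ (mem_set (OmK Omx)); rewrite /phi -/s.
    have [h ->] : exists h, x = p + h by exists (x - p); rewrite addrC subrK.
    rewrite [p + h - p]addrC addKr -[p + h - p0]addrAC.
    have hb : 0 <= inner (A (p + h)) (A (p + h)) + e ^+ 2.
      by rewrite addr_ge0 ?inner_ge0// sqr_ge0.
    have := ler_wpM2l C0 (le_sqrt_tangent se0 hb); rewrite -/s.
    set sh := Num.sqrt _; rewrite (adjoint_inner_sqrD AA) => hs hphi.
    rewrite !innerDl (adjoint_scale AA) innerZl /q.
    move: hphi; move: (p - p0) => d; rewrite innerDl !innerDr [inner h d]innerC.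
    have {hs}: C * sh <=
        C * s + C / s * inner (A' (A p)) h + C / (2 * s) * inner (A h) (A h).
      apply: (le_trans hs); rewrite le_eqVlt; apply/orP; left; apply/eqP.
      by field; rewrite gt_eqF.
    lra.
Qed.

(** The previous lemma is applied with e = [harmonic k] on a small closed ball inside [U], where
    local closedness of [Om] makes [K] compact. The multipliers stay in a compact ball and so have a
    cluster point. *)
Lemma penalized_minimizer_normal (U : set E) :
  nbhs p0 U -> closed (Om `&` U) -> Om p0 ->
  (\forall p \near p0, Om p ->
    inner c p0 <= inner c p + C * Num.sqrt (inner (A p) (A p))) ->
  exists y, limiting_normal Om p0 (- (c + A' y)).
Proof.
move=> nU cOU Op0 nmin.
have [_ cA' _] := AA.
have /nbhs_normP[r /= r0 rP] : nbhs p0 (U `&` [set p | Om p ->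
    inner c p0 <= inner c p + C * Num.sqrt (inner (A p) (A p))]) by apply: filterI.
have r20 : 0 < r / 2 by rewrite divr_gt0.
have r2P p : `|p0 - p| <= r / 2 -> U p /\ (Om p ->
    inner c p0 <= inner c p + C * Num.sqrt (inner (A p) (A p))).
  by move=> pr; apply: rP => /=; apply: (le_lt_trans pr); lra.
have cp0 : continuous (fun p => `|p0 - p|).
  move=> p; apply: (@continuous_comp _ _ _ (fun p => p0 - p) (fun p => `|p|)).
    by apply: cvgB; [exact: cvg_cst|exact: cvg_id].
  exact: norm_continuous.
pose K := Om `&` [set p | `|p0 - p| <= r / 2].
have cK : compact K.
  apply: (@subclosed_compact _ _ [set x | `|x| <= `|p0| + r / 2]).
  - have -> : K = (Om `&` U) `&` [set p | `|p0 - p| <= r / 2].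
      apply/seteqP; split => p.
        by move=> [Op pr]; split => //; split => //; case: (r2P _ pr).
      by move=> [[Op _]].
    apply: closedI => //; apply: (@closed_comp _ _ _ [set y : R | y <= r / 2]).
      by move=> p _; exact: cp0.
    exact: closed_le.
  - exact: compact_norm_ball.
  - move=> p [_ /= pr]; rewrite -[p](subKr p0); apply: (le_trans (ler_normB _ _)).
    by rewrite lerD2l.
have Kp0 : K p0 by split => //=; rewrite subrr normr0 ltW.
have hK p : K p -> inner c p0 <= inner c p + C * Num.sqrt (inner (A p) (A p)).
  by move=> [Op /r2P[_]]; apply.
have /choice[f fP] : forall k : nat, exists py : E * V,
    [/\ K py.1, `|py.1 - p0| ^+ 2 <= C * harmonic k, `|py.2| <= C &
    (\forall x \near py.1, Om x -> K x) ->
    regular_normal Om py.1 (- (c + A' py.2 + 2 *: (py.1 - p0)))].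
  move=> k; have [p [y h]] := smoothed_penalty_minimizer cK Kp0 (harmonic_gt0 k) hK.
  by exists (p, y).
have fc (e : R) : 0 < e -> \forall k \near \oo, `|p0 - (f k).1| < e.
  move=> e0; have hc : C * harmonic k @[k --> \oo] --> C * 0.
    by apply: cvgMl_tmp; exact: cvg_harmonic.
  have : \forall k \near \oo, C * harmonic k < e ^+ 2.
    by apply: (cvgr_lt _ hc); rewrite mulr0 exprn_gt0.
  apply: filterS => k kh; rewrite distrC -ltr_sqr ?nnegrE// ?ltW//.
  by case: (fP k) => _ h _ _; exact: le_lt_trans kh.
have [y [_ yc]] : [set x | `|x| <= C] `&` cluster ((fun k => (f k).2) @ \oo) !=set0.
  apply: (@compact_norm_ball _ _ eV C ((fun k => (f k).2) @ \oo)).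
  by apply: (@filterE _ \oo) => k; case: (fP k).
exists y; apply: limiting_normal_approx => e e0.
have e40 : 0 < e / 4 by rewrite divr_gt0.
have e20 : 0 < e / 2 by rewrite divr_gt0.
(* The bound r / 2 puts the minimizer inside the ball, so that its normality condition holds; e / 4
   makes the term 2 (p - p0) smaller than e / 2. *)
pose d := Num.min (r / 2) (e / 4).
have d0 : 0 < d by rewrite lt_min r20.
have nA : \forall v \near y, `|A' y - A' v| < e / 2.
  by have /cvgrPdist_lt := cA' y; apply.
(* No subsequence is extracted: a neighbourhood of the cluster point meets the image of the indices
   whose minimizer is close to p0, which gives one index good for both. *)
have nF : ((fun k => (f k).2) @ \oo)
    ((fun k => (f k).2) @` [set k | `|p0 - (f k).1| < d]).
  by apply: filterS (fc _ d0) => k kd; exists k.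
have [_ [[k /= kd <-] kA]] := yc _ _ nF nA.
have [[Om1 _] _ _ reg] := fP k; move: kd; rewrite lt_min => /andP[kr ke].
exists (f k).1, (- (c + A' (f k).2 + 2 *: ((f k).1 - p0))); split => //.
- apply: reg.
  have xr : \forall x \near (f k).1, `|p0 - x| < r / 2
    by exact: (cvgr_lt _ (cp0 (f k).1) _ kr).
  apply: filterS xr => x xr Omx.
  by split => //=; exact: ltW.
- by apply: (lt_trans ke); lra.
- rewrite opprK addrA [X in X + _]addrC opprD addrACA subrr add0r.
  apply: (le_lt_trans (ler_normD _ _));
  rewrite distrC normrZ ger0_norm// [`|_ - p0|]distrC.
  have -> : e = e / 2 + 2 * (e / 4) by field.
  by rewrite ltrD// ltr_pM2l.
Qed.

End penalized_linear_minimizer.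
End penalized_minimizers.

(** * Exact penalization and decoupling of the constraints *)

Section exact_penalization.
Context {R : realType}.

Lemma locally_lipschitz_near (X : innerModType R) (f : X -> R) (z : X) :
  locally_lipschitz f -> exists2 L : R, 0 <= L &
    exists2 W, nbhs z W & forall x y, W x -> W y -> f x <= f y + L * `|x - y|.
Proof.
move=> /(_ z)[W nW /pinfty_ex_gt0[L L0 LP]]; exists L; first exact: ltW.
exists W => // x y Wx Wy; rewrite -lerBlDl.
by apply: (le_trans (ler_norm _)); exact: (LP (x, y)).
Qed.

Lemma locally_lipschitz_continuous (X : innerModType R) (f : X -> R) :
  locally_lipschitz f -> continuous f.
Proof.
move=> f_lip z; have [L L0 [W nW fW]] := locally_lipschitz_near z f_lip.
apply/cvgrPdist_lt => e e0.
(* Dividing by L + 1 also covers L = 0. *)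
have eL : 0 < e / (L + 1) by rewrite divr_gt0// ltr_wpDl.
have nz : \forall x \near z, `|z - x| < e / (L + 1).
  by have /cvgrPdist_lt := @cvg_id _ (nbhs z); apply.
have Wz := nbhs_singleton nW; apply: filterS2 nz nW => x xz Wx.
have := fW _ _ Wx Wz; have := fW _ _ Wz Wx; rewrite [`|x - z|]distrC => h1 h2.
apply: (@le_lt_trans _ _ (L * `|z - x|)).
  by rewrite ler_norml; apply/andP; split; lra.
move: xz; rewrite ltr_pdivlMr ?ltr_wpDl//; have := normr_ge0 (z - x); nra.
Qed.

Lemma closed_setX (T U : topologicalType) (A : set T) (B : set U) :
  closed A -> closed B -> closed (A `*` B).
Proof.
move=> cA cB; have -> : A `*` B = fst @^-1` A `&` snd @^-1` B by [].
apply: closedI; apply: closed_comp => // p _; [exact: continuous_fst|exact: continuous_snd].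
Qed.

Lemma closed_epi (X : innerModType R) (f : X -> R) :
  locally_lipschitz f -> closed (epi f).
Proof.
move=> /locally_lipschitz_continuous cf.
have -> : epi f = (fun p => f p.1 - p.2) @^-1` [set y | y <= 0].
  by apply/seteqP; split => p /=; rewrite /epi/= subr_le0.
apply: closed_comp => [p _|]; last exact: closed_le.
apply: cvgB; last exact: continuous_snd.
by apply: (@continuous_comp _ _ _ fst f); [exact: continuous_fst|exact: cf].
Qed.

(** A solution x' of w in Y x' almost nearest to x stays near x0, since x0 is itself a solution.
    Hence g x0 <= g x' <= g x + L |x' - x|, and subregularity bounds |x' - x| by a multiple of |v -
    w| up to a vanishing slack. *)
Lemma exact_penalty (X W : innerModType R) {eX : euclidean X} {eW : euclidean W}
    (Y : X -> set W) (g : X -> R) (x0 : X) (w : W) (L : R) (N : set X) :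
  0 <= L -> nbhs x0 N ->
  (forall x y, N x -> N y -> g x <= g y + L * `|x - y|) ->
  metrically_subregular Y x0 w ->
  (\forall x \near x0, Y x w -> g x0 <= g x) ->
  exists2 C : R, 0 <= C & \forall x \near x0, forall v, Y x v ->
    g x0 <= g x + C * Num.sqrt (inner (v - w) (v - w)).
Proof.
move=> L0 nN gL [Yw [k k0 sub]] gmin.
have [D D0 hD] := @enorm_le_inner _ W _.
(* Lipschitz constant, subregularity modulus, and the factor comparing [enorm] with the
   inner-product norm. *)
exists (L * k * D); first by rewrite !mulr_ge0// ltW.
have /nbhs_normP[r /= r0 rP] : nbhs x0 (N `&` [set x | Y x w -> g x0 <= g x]).
  exact: filterI.
have r20 : 0 < r / 2 by rewrite divr_gt0.
apply: filterS2 sub (near_enorm_lt x0 r20) => x xsub xr v Yv.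
have Nx : N x.
  by have := @norm_le_enorm _ _ eX (x0 - x) => h; case: (rP x) => //=; lra.
have dx0 : (set_dist x [set x' | Y x' w] <= (enorm (x0 - x))%:E)%E.
  by apply: ereal_inf_lbound; exists x0.
have dv : (set_dist x [set x' | Y x' w] <= (k * enorm (v - w))%:E)%E.
  apply: (le_trans xsub); rewrite EFinM; apply: lee_wpmul2l.
    by rewrite lee_fin ltW.
  by apply: ereal_inf_lbound; exists v.
apply: (@le_trans _ _ (g x + L * (k * enorm (v - w)))); last first.
  rewrite lerD2l -!mulrA; apply: ler_wpM2l => //; apply: ler_wpM2l => //.
  exact: ltW.
apply/ler_addgt0Pr => e e0.
(* The first bound makes the slack cost at most e; the second keeps x' within r / 2 of x, hence
   within r of x0. *)
pose e' := Num.min (e / (L + 1)) (r / 2 - enorm (x0 - x)).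
have L1 : 0 < L + 1 by rewrite ltr_wpDl.
have e'0 : 0 < e' by rewrite lt_min divr_gt0//= subr_gt0.
have e'L : L * e' <= e.
  have : e' <= e / (L + 1) by rewrite ge_min lexx.
  by rewrite ler_pdivlMr//; nra.
have e'r : e' <= r / 2 - enorm (x0 - x) by rewrite ge_min lexx orbT.
(* Both quantities bound the distance to the solution set: one locates x', the other gives the
   penalty. *)
pose m := Num.min (enorm (x0 - x)) (k * enorm (v - w)).
have dm : (set_dist x [set x' | Y x' w] < (m + e')%:E)%E.
  apply: (@le_lt_trans _ _ m%:E); last by rewrite lte_fin ltrDl.
  by rewrite /m minEle; case: ifP.
have [_ [x' /= Yx' <-]] := ereal_inf_lt dm; rewrite lte_fin => x'm.
have m1 : m <= enorm (x0 - x) by rewrite ge_min lexx.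
have m2 : m <= k * enorm (v - w) by rewrite ge_min lexx orbT.
have hx := @norm_le_enorm _ _ eX (x0 - x).
have hx' := @norm_le_enorm _ _ eX (x' - x).
have [Nx' /(_ Yx') gx'] : (N `&` [set x | Y x w -> g x0 <= g x]) x'.
  apply: rP => /=; have := ler_distD x x0 x'; rewrite [`|x - x'|]distrC; lra.
have := gL _ _ Nx' Nx.
have : L * `|x' - x| <= L * (k * enorm (v - w) + e') by apply: ler_wpM2l => //; lra.
lra.
Qed.

(** The value f (pi q) is replaced by the height r of a free point (x, r) of [epi f], coupled to q
    through x - pi q; indeed f (pi q) <= r + L |x - pi q|. The multiplier u of this coupling enters
    the normal to [epi f] as -u and the normal to [Om] as pi' u. *)
Lemma lipschitz_penalized_normal (Z E V : innerModType R) {eZ : euclidean Z}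
    {eE : euclidean E} {eV : euclidean V} (f : Z -> R) (Om U : set E) (q0 : E)
    (pi : E -> Z) (pi' : Z -> E) (B : E -> V) (B' : V -> E) (C : R) :
  locally_lipschitz f -> adjoint pi pi' -> adjoint B B' -> B q0 = 0 ->
  nbhs q0 U -> closed (Om `&` U) -> Om q0 -> 0 <= C ->
  (\forall q \near q0, Om q ->
    f (pi q0) <= f (pi q) + C * Num.sqrt (inner (B q) (B q))) ->
  exists u y, limiting_subdiff f (pi q0) (- u) /\
    limiting_normal Om q0 (pi' u - B' y).
Proof.
move=> f_lip adpi adB Bq0 nU cOU Oq0 C0 nmin.
have [cpi _ _] := adpi.
have [L L0 [W nW fW]] := locally_lipschitz_near (pi q0) f_lip.
pose p0 : (Z * R^o) * E := ((pi q0, f (pi q0)), q0).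
(* The linear objective is the height r. *)
pose c : (Z * R^o) * E := ((0, 1), 0).
have adA : adjoint (fun p : (Z * R^o) * E => (p.1.1 - pi p.2, B p.2))
    (fun y => ((y.1, 0), 0) - (0, pi' y.1) + (0, B' y.2)).
  exact: (adjoint_pair
    (adjoint_sub (adjoint_comp adjoint_fst adjoint_fst) (adjoint_comp adjoint_snd adpi))
    (adjoint_comp adjoint_snd adB)).
(* The weight L + C pays for both couplings, as |x - pi q| and the inner-product norm of B q are
   each at most that of the pair. *)
have [||||||y /limiting_normal_prod[/= n1 n2]] := @penalized_minimizer_normal _ _ _ _ _
  (epi f `*` Om) p0 c _ _ (L + C) adA _ _ ([set: Z * R^o] `*` U).
- by rewrite /= subrr Bq0.
- exact: addr_ge0.
- exists (setT, U) => //; split => //; exact: filterT.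
- have -> : (epi f `*` Om) `&` ([set: Z * R^o] `*` U) = epi f `*` (Om `&` U).
    by apply/seteqP; split => p /=; tauto.
  have -> : epi f `*` (Om `&` U) = fst @^-1` epi f `&` snd @^-1` (Om `&` U) by [].
  apply: closedI; apply: closed_comp => //.
  + by move=> p _; exact: continuous_fst.
  + exact: closed_epi.
  + by move=> p _; exact: continuous_snd.
- by split => //; rewrite /epi/=.
- have nWx : \forall p \near p0, W p.1.1.
    exact: (continuous_comp (@continuous_fst _ _ p0) (@continuous_fst _ _ _) nW).
  have nWq : \forall p \near p0, W (pi p.2).
    exact: (continuous_comp (@continuous_snd _ _ p0) (cpi _) nW).
  have nq : \forall p \near p0, Om p.2 ->
      f (pi q0) <= f (pi p.2) + C * Num.sqrt (inner (B p.2) (B p.2)).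
    exact: (@continuous_snd _ _ p0 _ nmin).
  apply: filterS3 nWx nWq nq => -[[x r] q] /= Wx Wq fq [xr /fq {}fq].
  have ic p : inner c p = p.1.2.
    rewrite -[LHS]/((inner 0 p.1.1 + 1 * p.1.2) + inner 0 p.2).
    by rewrite !inner0l mul1r add0r addr0.
  rewrite !ic /=.
  rewrite -[inner (x - pi q, B q) _]/(inner (x - pi q) (x - pi q) + inner (B q) (B q)).
  have := fW _ _ Wq Wx; rewrite distrC.
  have a0 : 0 <= inner (x - pi q) (x - pi q) by exact: inner_ge0.
  have b0 : 0 <= inner (B q) (B q) by exact: inner_ge0.
  have : Num.sqrt (inner (B q) (B q)) <=
      Num.sqrt (inner (x - pi q) (x - pi q) + inner (B q) (B q)).
    by rewrite ler_wsqrtr// lerDr.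
  have : `|x - pi q| <= Num.sqrt (inner (x - pi q) (x - pi q) + inner (B q) (B q)).
    rewrite -[leLHS]normr_id -sqrtr_sqr ler_wsqrtr//.
    by apply: (le_trans (norm_le_inner _));
      rewrite lerDl.
  rewrite /epi/= in xr; set t := Num.sqrt (_ + _).
  by move=> /(ler_wpM2l L0) h1 /(ler_wpM2l C0) h2 h3; lra.
exists y.1, y.2; split.
  rewrite subr0 addr0 in n1.
  rewrite -[X in limiting_normal _ _ X]/(- (0 + y.1), - (1 + 0)) add0r addr0 in n1.
  exact: n1.
by rewrite !add0r opprD opprK in n2.
Qed.

(** Common core of the implicit case, where [pi] is the identity, and the fuzzy case, where it
    projects onto z. The free variables are (x, w) in [gph Y] and z in [M], coupled through w and pi
    x - z with multipliers nu and eta. *)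
Lemma subregular_gph_normal (Z X W : innerModType R) {eZ : euclidean Z}
    {eX : euclidean X} {eW : euclidean W} (f : Z -> R) (pi : X -> Z) (pi' : Z -> X)
    (Y : X -> set W) (M : set Z) (x0 : X) :
  locally_lipschitz f -> adjoint pi pi' -> closed M -> locally_closed (gph Y) ->
  (forall x y, `|pi x - pi y| <= `|x - y|) ->
  metrically_subregular (fun x => Y x `*` [set pi x - u | u in M]) x0 0 ->
  (\forall x \near x0, Y x 0 -> M (pi x) -> f (pi x0) <= f (pi x)) ->
  exists u nu eta, [/\ limiting_subdiff f (pi x0) (- u),
    coderivative Y x0 0 nu (pi' u - pi' eta) & limiting_normal M (pi x0) eta].
Proof.
move=> f_lip adpi cM cY pi1 sub nmin; have [cpi _ _] := adpi.
have [] := sub; rewrite /gph/= => -[/= Yx0 [u0 Mu0 /eqP]] + _.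
rewrite subr_eq0 => /eqP pu; rewrite -pu in Mu0.
have [U [nU cU cYU]] := cY (x0, 0) Yx0.
have [L L0 [N nN fN]] := locally_lipschitz_near (pi x0) f_lip.
have [C C0 pen] : exists2 C : R, 0 <= C & \forall x \near x0, forall v,
    (Y x `*` [set pi x - u | u in M]) v ->
    f (pi x0) <= f (pi x) + C * Num.sqrt (inner (v - 0) (v - 0)).
  apply: (exact_penalty (Y := fun x => Y x `*` [set pi x - u | u in M])
    (g := fun x => f (pi x)) (w := 0) L0 (N := pi @^-1` N)) => //.
  - exact: cpi.
  - move=> x y /= Nx Ny; apply: (le_trans (fN _ _ Nx Ny)).
    by rewrite lerD2l ler_wpM2l.
  - apply: filterS nmin => x xmin [/= Yx [u Mu /eqP]]; rewrite subr_eq0 => /eqP xu.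
    by apply: xmin => //; rewrite xu.
pose q0 : (X * W) * Z := ((x0, 0), pi x0).
have adB : adjoint (fun q : (X * W) * Z => (q.1.2, pi q.1.1 - q.2))
    (fun y => ((0, y.1), 0) + (((pi' y.2, 0), 0) - (0, y.2))).
  exact: (adjoint_pair (adjoint_comp adjoint_fst adjoint_snd)
    (adjoint_sub (adjoint_comp adjoint_fst (adjoint_comp adjoint_fst adpi)) adjoint_snd)).
have adp : adjoint (fun q : (X * W) * Z => pi q.1.1) (fun u => ((pi' u, 0), 0)).
  exact: (adjoint_comp adjoint_fst (adjoint_comp adjoint_fst adpi)).
have [||||||u [y [fu /limiting_normal_prod[/= n1 n2]]]] :=
  @lipschitz_penalized_normal _ _ _ _ _ _
  f (gph Y `*` M) (U `*` setT) q0 _ _ _ _ C f_lip adp adB.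
- by rewrite /= subrr.
- by exists (U, setT) => //; split => //; exact: filterT.
- have -> : (gph Y `*` M) `&` (U `*` setT) = fst @^-1` (gph Y `&` U) `&` snd @^-1` M.
    by apply/seteqP; split => p /=; tauto.
  apply: closedI; apply: closed_comp => //.
  + by move=> p _; exact: continuous_fst.
  + by move=> p _; exact: continuous_snd.
- by [].
- by [].
- have npen : \forall q \near q0, forall v, (Y q.1.1 `*` [set pi q.1.1 - u | u in M]) v ->
      f (pi x0) <= f (pi q.1.1) + C * Num.sqrt (inner (v - 0) (v - 0)).
    exact: (continuous_comp (@continuous_fst _ _ q0) (@continuous_fst _ _ _) pen).
  (* The coupling (w, pi x - z) is itself an element of the set value at x, so the penalty estimate
     applies to it. *)
  apply: filterS npen => -[[x w] z] /= xpen [/= Yw Mz].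
  by have := xpen (w, pi x - z); rewrite subr0; apply; split => //=; exists z.
exists u, y.1, y.2; split => //.
  rewrite subr0 -[X in limiting_normal _ _ X]/
    (pi' u - (0 + pi' y.2), 0 - (y.1 + 0)) in n1.
  by rewrite add0r addr0 sub0r in n1.
by rewrite !sub0r opprK in n2.
Qed.

End exact_penalization.

(** * Implicit, fuzzy and explicit stationarity of local minimizers *)

Theorem proposition4p11 (R : realType) (n m s : nat)
  (f : 'rV[R]_n -> R)
  (F : 'rV[R]_n -> set 'rV[R]_m)
  (G : 'rV[R]_n * 'rV[R]_m -> set 'rV[R]_s)
  (M : set 'rV[R]_n)
  (f_lip : locally_lipschitz f)
  (F_closed : closed (gph F))
  (G_closed : closed (gph G))
  (M_nonempty : M !=set0)
  (M_closed : closed M)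
  (H_closed : locally_closed (gph (Hmap F G)))
  (zbar : 'rV[R]_n)
  (zbar_min : local_minimizer f F G M zbar) :
  [/\ metrically_subregular (Hmap_M F G M) zbar (0, 0) ->
        implicitly_M_stationary f F G M zbar,
      forall lambdabar, Kmap F G zbar lambdabar ->
        metrically_subregular (calHM F G M) (zbar, lambdabar) (0, 0, 0) ->
        fuzzily_M_stationary f F G M zbar lambdabar
    & forall lambdabar, Kmap F G zbar lambdabar ->
        metrically_subregular (frakHM F G M) (zbar, lambdabar)
          (0, 0, (0, 0, 0), 0) ->
        explicitly_M_stationary f F G M zbar lambdabar].
Proof.
have [[Hz Mz] zmin] := zbar_min.
split.
- move=> sub.
  (* The three summands will be -u, u - eta and eta. *)
  have [||u [nu [eta [fu Hu Mu]]]] := @subregular_gph_normal _ _ _ _ _ _ _ f id id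
     (Hmap F G) M zbar f_lip (adjoint_id _) M_closed H_closed _ sub.
  + by [].
  + by apply: filterS zmin => x xmin Hx Mx; exact: xmin.
  split => //; exists nu; exists (- u + (u - eta)).
    by exists (- u) => //; exists (u - eta).
  by exists eta => //; rewrite addrA addNr add0r addNr.
- move=> lam Kl sub.
  have cH : closed (gph (calH F G)).
    (* Adding lambda back to the first component undoes the translation in [calH]. *)
    have -> : gph (calH F G) = (fun p => (p.1.1, p.2.1 + p.1.2)) @^-1` gph F `&`
        (fun p => (p.1, p.2.2)) @^-1` gph G.
      apply/seteqP; split => -[[z l] [a b]] /=; rewrite /gph/=;
        move=> -[/= h1 h2]; split => //=.
        by case: h1 => l' Fl <-; rewrite subrK.
      by exists (a + l) => //; rewrite addrK.
    apply: closedI; apply: closed_comp => // p _.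
      have c1 := continuous_comp (@continuous_fst _ _ p) (@continuous_fst _ _ _).
      have c2 := continuous_comp (@continuous_fst _ _ p) (@continuous_snd _ _ _).
      have c3 := continuous_comp (@continuous_snd _ _ p) (@continuous_fst _ _ _).
      exact: (cvg_pair c1 (cvgD c3 c2)).
    have c4 := continuous_comp (@continuous_snd _ _ p) (@continuous_snd _ _ _).
    exact: (cvg_pair (@continuous_fst _ _ p) c4).
  (* The adjoint of [fst] pads with 0, which produces the zero lambda-components of the fuzzy
     system. *)
  have [|||u [nu [eta [fu Hu Mu]]]] :=
    @subregular_gph_normal _ _ _ _ _ _ _ f fst (fun x => (x, 0))
     (calH F G) M (zbar, lam) f_lip adjoint_fst M_closed _ _ sub.
  + by move=> p cp; exists setT; rewrite setIT; split => //; exact: filterT.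
  + by move=> x y; rewrite prod_normE/= le_max lexx.
  + have npmin : \forall p \near (zbar, lam), feasible F G M p.1 -> f zbar <= f p.1.
      exact: (@continuous_fst _ _ (zbar, lam) _ zmin).
    apply: filterS npmin => -[z l] /= xmin [/= [l' Fl /subr0_eq l'E] Gl Mz'].
    by apply: xmin; split => //; exists l' => //; rewrite l'E.
  case: nu Hu => mu nu Hu; split => //; exists mu, nu.
  exists ((- u, 0) + ((u, 0) - (eta, 0))).
    by exists (- u, 0) => //; exists ((u, 0) - (eta, 0)).
  by exists (eta, 0) => //; rewrite addrA subrK -[LHS]/(- u + u, 0 + 0) addNr addr0.
- move=> lam Kl sub; have [Fl Gl] := Kl.
  pose EF : innerModType R := ('rV[R]_n * 'rV[R]_m)%type.
  pose EG : innerModType R := (EF * 'rV[R]_s)%type.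
  have [L L0 [N nN fN]] := locally_lipschitz_near zbar f_lip.
  have [C C0 pen] : exists2 C : R, 0 <= C & \forall x \near (zbar, lam), forall v,
      frakHM F G M x v -> f zbar <= f x.1 + C * Num.sqrt (inner (v - 0) (v - 0)).
    apply: (exact_penalty (g := fun x => f x.1) (w := 0) L0 (N := fst @^-1` N)) => //.
    + exact: (@continuous_fst _ _ (zbar, lam) _ nN).
    + move=> x y /= Nx Ny; apply: (le_trans (fN _ _ Nx Ny)).
      by rewrite lerD2l ler_wpM2l// prod_normE/= le_max lexx.
    + have npmin : \forall p \near (zbar, lam), feasible F G M p.1 -> f zbar <= f p.1.
        exact: (@continuous_fst _ _ (zbar, lam) _ zmin).
      apply: filterS npmin => p xmin.
      (* Zero residuals put p in [gph F], (p, 0) in [gph G] and p.1 in [M], so p.2 witnesses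
         feasibility of p.1. *)
      move=> [/= [[qF FqF /subr0_eq FE] [qG GqG /subr0_eq GE]] [z Mz' /subr0_eq zE]].
      apply: xmin; split; last by rewrite zE.
      rewrite -FE -GE in FqF GqG; exists p.2 => //.
      by case: p GqG {FqF FE GE zE}.
  pose q0 : (EF * EG) * 'rV[R]_n := (((zbar, lam), ((zbar, lam), 0)), zbar).
  (* For p in [gph F], (p', w) in [gph G] and z in [M], the couplings are p - p', w and p.1 - z: the
     point of [gph F] itself serves as the argument of [frakHM]. *)
  pose B (q : (EF * EG) * 'rV[R]_n) : (EF * 'rV[R]_s) * 'rV[R]_n :=
    ((q.1.1 - q.1.2.1, q.1.2.2), q.1.1.1 - q.2).
  pose B' (y : (EF * 'rV[R]_s) * 'rV[R]_n) : (EF * EG) * 'rV[R]_n :=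
    (((y.1.1, 0), 0) - ((0, (y.1.1, 0)), 0) + ((0, (0, y.1.2)), 0)) +
    ((((y.2, 0), 0), 0) - (0, y.2)).
  have adB : adjoint B B'.
    exact: (adjoint_pair
      (adjoint_pair
        (adjoint_sub (adjoint_comp adjoint_fst adjoint_fst)
           (adjoint_comp (adjoint_comp adjoint_fst adjoint_snd) adjoint_fst))
        (adjoint_comp (adjoint_comp adjoint_fst adjoint_snd) adjoint_snd))
      (adjoint_sub (adjoint_comp (adjoint_comp adjoint_fst adjoint_fst) adjoint_fst)
        adjoint_snd)).
  have adp : adjoint (fun q : (EF * EG) * 'rV[R]_n => q.1.1.1)
      (fun u => (((u, 0), 0), 0)).
    exact: (adjoint_comp (adjoint_comp adjoint_fst adjoint_fst) adjoint_fst).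
  have [||||||u [y [fu /limiting_normal_prod[/= /limiting_normal_prod[/= nF nG] nM]]]] :=
    @lipschitz_penalized_normal _ _ _ _ _ _ _
      f ((gph F `*` gph G) `*` M) setT q0 _ _ _ _ C f_lip adp adB.
  + by rewrite /B/= !subrr.
  + exact: filterT.
  + rewrite setIT.
    apply: (@closed_setX _ _ (gph F `*` gph G) M) => //.
    exact: (@closed_setX _ _ (gph F) (gph G)).
  + by [].
  + by [].
  + have npen : \forall q \near q0, forall v, frakHM F G M q.1.1 v ->
        f zbar <= f q.1.1.1 + C * Num.sqrt (inner (v - 0) (v - 0)).
      exact: (continuous_comp (@continuous_fst _ _ q0) (@continuous_fst _ _ _) pen).
    apply: filterS npen => -[[p [p' w]] z] /= xpen [/= [Fp Gp] Mz'].
    (* Choosing p in [gph F] makes the first residual 0; the others match [B] up to the sign of w,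
       which the inner square ignores. *)
    have /= := xpen (((p - p), ((p, 0) - (p', w))), p.1 - z).
    rewrite subr0 => /(_ _)/wrap[].
      by split => /=; [split => /=; [exists p|exists (p', w)]|exists z].
    rewrite subrr -[inner _ _ in X in X -> _]/(inner (0 : EF) 0 +
      (inner (p - p') (p - p') + inner (0 - w) (0 - w)) + inner (p.1 - z) (p.1 - z)).
    by rewrite inner0l add0r sub0r innerNl innerNr opprK.
  (* The normals become (u - (y1 + eta), -mu) to [gph F], ((y1, mu), -nu) to [gph G] and eta to [M].
     The coupling p - p' thus makes the same mu appear in both coderivatives, and the z-components
     cancel with -u. *)
  case: y nF nG nM => [[[y1 mu] nu] eta] /=.
  rewrite !subr0 !addr0 -[X in limiting_normal _ _ X -> _]/(u - (y1 + eta), 0 - (mu + 0)).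
  rewrite addr0 !sub0r opprD opprK => nF.
  rewrite opprD opprK -[X in limiting_normal _ _ X -> _]/((y1, mu) - 0, 0 - nu).
  rewrite subr0 sub0r => nG nM.
  rewrite -opprD in nF; split => //; exists mu, nu.
  exists (- u + (u - (y1 + eta)) + y1).
    exists (- u + (u - (y1 + eta))); last by exists y1.
    by exists (- u) => //; exists (u - (y1 + eta)).
  by exists eta => //; rewrite -addrA addKr addNr.
Qed.
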